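(* Let $I=[0,\infty]$, let $\mu$ be a Borel probability measure on $I$, and let $\tau_1,\tau_2,\dots$ be i.i.d. with law $\mu$ under $\mathbb{P}$. Fix $T>0$, $\mathsf{R}\ge0$, $0\le\alpha<\beta\le1$, put $F(T-)=\mu[0,T)$, and assume $\alpha>F(T-)>0$ and $\mu[0,T')<\mu[0,T]$ for all $T'\in[0,T)$. Define $L^{(N)}_t=\frac1N\sum_{n=1}^N\chi_{\{\tau_n\le t\}}$, $\bar L^{(N)}_t=\frac{(L^{(N)}_t-\alpha)^+-(L^{(N)}_t-\beta)^+}{\beta-\alpha}$, $\mathbf{P}^{\mathrm{prot}}_N=\int_{[0,T)}e^{-\mathsf{R}s}d\bar L^{(N)}_s$, $\varkappa=\ln\big(\frac{\alpha}{1-\alpha}\frac{1-F(T-)}{F(T-)}\big)$, $\mathfrak{I}(\alpha)=\inf\{H(\mu'|\mu):\mu'\in\mathscr{P}(I),\ \mu'[0,T)\ge\alpha\}$, and $$\tilde\mu^*_\alpha(A)=\mu(A\cap[0,T))\frac{\alpha}{F(T-)}+\mu(A\cap[T,\infty])\frac{1-\alpha}{1-F(T-)}.$$ For each $N\ge1$ define the probability measure $\tilde{\mathbb{P}}_N(A)=\mathbb{E}\big[\chi_A\prod_{n=1}^N\frac{d\tilde\mu^*_\alpha}{d\mu}(\tau_n)\big]$ (with expectation $\tilde{\mathbb{E}}_N$) and $\gamma_N=\sum_{n=1}^N\{\chi_{[0,T)}(\tau_n)-\alpha\}=N(L^{(N)}_{T-}-\alpha)$. Then for every positive integer $N$, $$\mathbb{E}[\mathbf{P}^{\mathrm{prot}}_N]=I_Ne^{-N\mathfrak{I}(\alpha)},\qquad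 I_N=\tilde{\mathbb{E}}_N\big[\mathbf{P}^{\mathrm{prot}}_N\exp[-\varkappa\gamma_N]\chi_{\{\gamma_N>0\}}\big],$$ and under $\tilde{\mathbb{P}}_N$ the random variables $\tau_1,\dots,\tau_N$ are i.i.d. with common law $\tilde\mu^*_\alpha$.
   Context: $\mathscr{P}(I)$ is the set of Borel probability measures on $I=[0,\infty]$ (compactified half-line). $H(\mu'|\mu)=\int\ln\frac{d\mu'}{d\mu}\,d\mu'$ if $\mu'\ll\mu$, $\infty$ otherwise. $L^{(N)}_{T-}$ is the left limit at $T$, i.e. $\frac1N\sum_n\chi_{[0,T)}(\tau_n)$. *)

(* Defs.v *)
From HB Require Import structures.
From mathcomp Require Import all_boot all_order all_algebra.
From mathcomp Require Import all_classical all_reals all_analysis.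
From mathcomp Require Import measurable_realfun.
Set Implicit Arguments. Unset Strict Implicit. Unset Printing Implicit Defensive.
Import Order.TTheory GRing.Theory Num.Def Num.Theory.
Import numFieldNormedType.Exports.
Local Open Scope classical_set_scope.
Local Open Scope ring_scope.

(* Riemann-Stieltjes / Lebesgue-Stieltjes integral  int_D g dF  for a   *)
(* nondecreasing right-continuous integrator F : R -> R (the integral   *)
(* against the Lebesgue-Stieltjes measure of F).  Set to 0 if F is not  *)
(* cumulative (never used in that case).                                *)
Definition stieltjes_integral {R : realType} (F : R -> R) (D : set R)
    (g : R -> R) : \bar R :=
  match pselect (nondecreasing F /\ right_continuous F) with
  | left H =>
      let cF : cumulative R R :=
        HB.pack F (isCumulative.Build R _ R F (proj1 H) (proj2 H)) in
      (\int[lebesgue_stieltjes_measure cF]_(x in (D : set (ocitv_type R)))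
         (g x)%:E)%E
  | right _ => 0%E
  end.

Definition setI_ {R : realType} : set (\bar R) := `[0%E, +oo%E]%classic.
Definition set0T {R : realType} (T : R) : set (\bar R) :=
  `[0%E, T%:E[%classic.
Definition set0Tc {R : realType} (T : R) : set (\bar R) :=
  `[0%E, T%:E]%classic.
Definition setTinf {R : realType} (T : R) : set (\bar R) :=
  `[T%:E, +oo%E]%classic.

Lemma measurable_set0T {R : realType} (T : R) : measurable (set0T T).
Proof. exact: emeasurable_itv. Qed.
Lemma measurable_setTinf {R : realType} (T : R) : measurable (setTinf T).
Proof. exact: emeasurable_itv. Qed.

Definition FTm {R : realType} (mu : probability (\bar R) R) (T : R) : R :=
  fine (mu (set0T T)).

(* The tilted measure  mu~*_alpha (as a charge, i.e. a finite signed      *)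
(* measure; it is in fact a probability measure):                         *)
(*  mu~(A) = mu(A & [0,T)) alpha/F(T-) + mu(A & [T,oo]) (1-alpha)/(1-F(T-)) *)
Definition mu_tilde {R : realType} (mu : probability (\bar R) R) (T alpha : R)
  : {charge set (\bar R) -> \bar R} :=
  cadd
    (cscale (alpha / FTm mu T)
       (crestr0 (charge_of_finite_measure mu) (measurable_set0T T)))
    (cscale ((1 - alpha) / (1 - FTm mu T))
       (crestr0 (charge_of_finite_measure mu) (measurable_setTinf T))).

Definition rel_entropy {R : realType} (mu' mu : probability (\bar R) R)
  : \bar R :=
  match pselect (mu' `<< mu) with
  | left _ => (\int[mu']_x
        (ln (fine (Radon_Nikodym (charge_of_finite_measure mu') mu x)))%:E)%E
  | right _ => +oo%E
  end.

Definition frakI {R : realType} (mu : probability (\bar R) R) (T alpha : R)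
  : \bar R :=
  ereal_inf [set rel_entropy mu' mu | mu' in
    [set mu' : probability (\bar R) R |
       mu' setI_ = 1%E /\ (alpha%:E <= mu' (set0T T))%E]].

Definition iid_with_law {d} {Omega : measurableType d} {R : realType}
    (P : set Omega -> \bar R) (tau : nat -> Omega -> \bar R) (J : set nat)
    (nu : set (\bar R) -> \bar R) : Prop :=
  (forall n, J n -> forall B : set (\bar R), measurable B ->
      P (tau n @^-1` B) = nu B) /\
  (forall (s : seq nat) (B : nat -> set (\bar R)),
      uniq s -> (forall n, n \in s -> J n) -> (forall n, measurable (B n)) ->
      P (\bigcap_(n in [set n | n \in s]) (tau n @^-1` B n)) =
      (\prod_(n <- s) P (tau n @^-1` B n))%E).

(* Empirical objects (indices n = 0, ..., N-1 stand for 1, ..., N)       *)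
Section empirical.
Context {d} {Omega : measurableType d} {R : realType}.
Variable tau : nat -> Omega -> \bar R.

Definition LN (N : nat) (w : Omega) (t : R) : R :=
  N%:R^-1 * \sum_(n < N) ((tau n w <= t%:E)%E)%:R.

Definition LbarN (alpha beta : R) (N : nat) (w : Omega) (t : R) : R :=
  (Num.max (LN N w t - alpha) 0 - Num.max (LN N w t - beta) 0)
  / (beta - alpha).

Definition Pprot (T r alpha beta : R) (N : nat) (w : Omega) : \bar R :=
  stieltjes_integral (LbarN alpha beta N w) `[0, T[%classic
    (fun s => expR (- (r * s))).

Definition gammaN (T alpha : R) (N : nat) (w : Omega) : R :=
  \sum_(n < N) ((tau n w \in set0T T)%:R - alpha).
End empirical.

Definition dens {R : realType} (mu : probability (\bar R) R) (T alpha : R)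
  : \bar R -> \bar R :=
  Radon_Nikodym (mu_tilde mu T alpha) mu.

Definition PtildeN {d} {Omega : measurableType d} {R : realType}
    (P : probability Omega R) (mu : probability (\bar R) R)
    (tau : nat -> Omega -> \bar R) (T alpha : R) (N : nat)
    (A : set Omega) : \bar R :=
  (\int[P]_w ((\1_A w)%:E * \prod_(n < N) dens mu T alpha (tau n w)))%E.

Definition EtildeN {d} {Omega : measurableType d} {R : realType}
    (P : probability Omega R) (mu : probability (\bar R) R)
    (tau : nat -> Omega -> \bar R) (T alpha : R) (N : nat)
    (X : Omega -> \bar R) : \bar R :=
  (\int[P]_w (X w * \prod_(n < N) dens mu T alpha (tau n w)))%E.

(* Main.v *)
Require Import Defs.
From HB Require Import structures.
From mathcomp Require Import all_boot all_order all_algebra.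
From mathcomp Require Import all_classical all_reals all_analysis.
From mathcomp Require Import measurable_realfun ring lra.
Import Order.TTheory GRing.Theory Num.Def Num.Theory.
Local Open Scope classical_set_scope.
Local Open Scope ring_scope.

(* With [a = alpha / F(T-)], [b = (1 - alpha) / (1 - F(T-))], the tilted measure
   has the two-valued density [g = a] on [0, T) and [g = b] elsewhere.  Gibbs'
   inequality shows that it minimizes the relative entropy under the constraint
   [mu'[0, T) >= alpha], so [frakI = alpha * ln a + (1 - alpha) * ln b].  Since
   [kappa = ln a - ln b], one has [g x = exp (kappa * (1_[0, T) x - alpha) + frakI],
   hence the density of [P~_N] is [exp (kappa * gamma_N + N * frakI)] and the
   exponentials cancel in [I_N]; the restriction to [gamma_N > 0] is harmless
   because [L_t <= alpha] for all [t < T] when [gamma_N <= 0], so that the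
   integrator [Lbar] vanishes before [T].  The integral identities hold without
   knowing that the random variable [Pprot] is measurable, the integral being
   a supremum over simple functions. *)

(** * Comparison and scaling of integrals of possibly non-measurable functions *)

Section integral_without_measurability.
Local Open Scope ereal_scope.
Context d (T : measurableType d) (R : realType) (m : {measure set T -> \bar R}).
Implicit Types f g : T -> \bar R.
Import HBNNSimple.

(** A simple function below [f], cut to 0 on the exceptional null set [N], lies below [g] everywhere
    and keeps its integral; so each term of the supremum for [f] is matched in the supremum for
    [g]. *)
Lemma ge0_ae_le_integralT f g :
  (forall x, 0 <= f x) -> (forall x, 0 <= g x) ->
  {ae m, forall x, f x <= g x} -> \int[m]_x f x <= \int[m]_x g x.
Proof.
move=> f0 g0 [N [mN N0 fgN]].
rewrite !ge0_integralTE//; apply: ge_ereal_sup => _ [h /= hf <-].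
have mNC : measurable (~` N) by exact: measurableC.
apply: ereal_sup_ubound; exists (proj_nnsfun h mNC) => /=.
  move=> x; rewrite mindicE; case: (boolP (x \in ~` N)) => xN.
    rewrite mulr1; apply: (le_trans (hf x)).
    by apply: contrapT => fgx; move: xN; rewrite inE; apply; exact: fgN.
  by rewrite mulr0.
rewrite -!integralT_nnsfun; apply: ae_eq_integral => //.
- exact/measurable_EFinP.
- exact/measurable_EFinP.
- exists N; split => // x /= xN; apply: contrapT => Nx; apply: xN => _.
  by rewrite mindicE mem_set// mulr1.
Qed.

Lemma ae_eq_integralT f g :
  {ae m, forall x, f x = g x} -> \int[m]_x f x = \int[m]_x g x.
Proof.
move=> fg; rewrite integralE [RHS]integralE.
congr (_ - _); apply/eqP; rewrite eq_le; apply/andP; split;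
  apply: ge0_ae_le_integralT => //; apply: filterS fg => x fgx;
  by rewrite ?funeposE ?funenegE fgx.
Qed.

(** Scaling the simple functions below a function gives one inequality for every positive factor;
    the reverse one is the same inequality for [k * f] and the factor [k^-1]. *)
Lemma ge0_integralTZl f (k : R) : (forall x, 0 <= f x) -> (0 < k)%R ->
  \int[m]_x (k%:E * f x) = k%:E * \int[m]_x f x.
Proof.
have le_scale (h : T -> \bar R) (c : R) : (forall x, 0 <= h x) -> (0 < c)%R ->
    c%:E * \int[m]_x h x <= \int[m]_x (c%:E * h x).
  move=> h0 c0; rewrite muleC -lee_pdivlMr// [leLHS]ge0_integralTE//.
  rewrite ge0_integralTE; last by move=> x; rewrite mule_ge0// lee_fin ltW.
  apply: ge_ereal_sup => _ [s /= sh <-].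
  rewrite lee_pdivlMr// muleC -sintegralrM; apply: ereal_sup_ubound.
  exists (scale_nnsfun s (ltW c0)) => //= x.
  by rewrite EFinM lee_wpmul2l// lee_fin ltW.
move=> f0 k0; apply/eqP; rewrite eq_le le_scale// andbT.
rewrite muleC -lee_pdivrMr// muleC.
have kf0 x : 0 <= k%:E * f x by rewrite mule_ge0// lee_fin ltW.
apply: (le_trans (le_scale _ _ kf0 _)); first by rewrite invr_gt0.
rewrite le_eqVlt; apply/orP; left; apply/eqP; apply: eq_integral => x _.
by rewrite muleA -EFinM mulVf ?mul1e// gt_eqF.
Qed.

Lemma ae_le_integralT f g :
  {ae m, forall x, f x <= g x} ->
  \int[m]_x f x <= \int[m]_x g x.
Proof.
move=> fg; rewrite integralE [leRHS]integralE.
apply: leeB; apply: ge0_ae_le_integralT => //.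
- by apply: filterS fg => x fgx; rewrite !funeposE ge_max !le_max fgx lexx orbT.
- by apply: filterS fg => x fgx; rewrite !funenegE ge_max !le_max leeN2 fgx lexx orbT.
Qed.

End integral_without_measurability.

(** * Two-valued functions and measures having them as density *)

Definition twoval {X : Type} {R : realType} (S : set X) (u v : R) (x : X) : R :=
  if x \in S then u else v.

Section two_valued_density.
Local Open Scope ereal_scope.
Context d (X : measurableType d) (R : realType) (S : set X).
Hypothesis mS : measurable S.
Implicit Types (u v : R) (A : set X).

Lemma twovalE u v : twoval S u v = (fun x => u * \1_S x + v * \1_(~` S) x)%R.
Proof.
apply/funext => x; rewrite /twoval !indicE in_setC.
by case: (x \in S); rewrite ?mulr1 ?mulr0 ?addr0 ?add0r.
Qed.

Lemma measurable_twoval u v : measurable_fun setT (twoval S u v).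
Proof.
rewrite twovalE; apply: measurable_funD; apply: measurable_funM => //.
by apply: measurable_indic; exact: measurableC.
Qed.

Lemma integral_twoval (m : {finite_measure set X -> \bar R}) u v A :
  measurable A ->
  \int[m]_(x in A) (twoval S u v x)%:E =
  u%:E * m (A `&` S) + v%:E * m (A `&` ~` S).
Proof.
move=> mA; have mSC := measurableC mS.
have intI (B : set X) : measurable B ->
    m.-integrable A (fun x => (\1_B x)%:E).
  move=> mB; apply: (integrableS measurableT) => //; exact: integrable_indic.
under eq_integral do rewrite twovalE EFinD !EFinM.
rewrite integralD//; last 2 first.
- by apply: integrableZl => //; exact: intI.
- by apply: integrableZl => //; exact: intI.
rewrite !integralZl ?integral_indic//; try exact: intI.
by rewrite ![_ `&` A]setIC.
Qed.

Lemma integrable_twoval (m : {finite_measure set X -> \bar R}) u v :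
  m.-integrable setT (EFin \o twoval S u v).
Proof.
have mSC := measurableC mS.
have -> : EFin \o twoval S u v =
    (fun x => u%:E * (\1_S x)%:E) \+ (fun x => v%:E * (\1_(~` S) x)%:E).
  by apply/funext => x /=; rewrite twovalE EFinD !EFinM.
by apply: integrableD => //; apply: integrableZl => //; exact: integrable_indic.
Qed.

Section radon_nikodym_twoval.
Variables (mu : probability X R) (nu : {charge set X -> \bar R}) (u v : R).
Hypothesis nuE : forall A, measurable A ->
  nu A = u%:E * mu (A `&` S) + v%:E * mu (A `&` ~` S).

Lemma twoval_dominates : nu `<< mu.
Proof.
apply/null_content_dominatesP => A mA A0; rewrite nuE//.
have sub0 B : measurable B -> mu (A `&` B) = 0.
  move=> mB; apply/eqP; rewrite eq_le measure_ge0 andbT -A0 le_measure// inE//.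
  exact: measurableI.
by rewrite !sub0 ?mule0 ?adde0//; exact: measurableC.
Qed.

(** Both functions are integrable and have integral [nu E] over every measurable [E], which
    determines a density up to a null set. *)
Lemma Radon_Nikodym_twoval :
  {ae mu, forall x, Radon_Nikodym nu mu x = (twoval S u v x)%:E}.
Proof.
have numu := twoval_dominates.
have : ae_eq mu setT (Radon_Nikodym nu mu) (EFin \o twoval S u v).
  apply: integral_ae_eq => //.
  - exact: Radon_Nikodym_integrable.
  - by apply/measurable_EFinP; exact: measurable_twoval.
  - move=> E _ mE; rewrite -Radon_Nikodym_integral// nuE//.
    by rewrite integral_twoval.
by apply: filterS => x /(_ I).
Qed.

End radon_nikodym_twoval.
End two_valued_density.
Arguments measurable_twoval {d X R S}.
Arguments integral_twoval {d X R S}.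

(** * Gibbs' inequality and the entropy of the tilted law *)

Lemma ln_ge_1BV {R : realType} (x y : R) : 0 < x -> 0 < y ->
  ln x + 1 - x / y <= ln y.
Proof.
move=> x0 y0; have xy0 : 0 < x / y by rewrite divr_gt0.
have := @le_ln1Dx R (x / y - 1).
rewrite [1 + _]addrC subrK ln_div ?posrE// ltrBrDl addrN => /(_ xy0).
lra.
Qed.

Section tilted_entropy.
Local Open Scope ereal_scope.
Context (R : realType) (mu : probability (\bar R) R) (S : set (\bar R)).
Hypothesis mS : measurable S.
Variable alpha : R.
Let F : R := fine (mu S).
Hypotheses (F0 : (0 < F)%R) (Falpha : (F < alpha)%R) (alpha1 : (alpha < 1)%R).
Let a : R := (alpha / F)%R.
Let b : R := ((1 - alpha) / (1 - F))%R.

Let muS : mu S = F%:E.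
Proof. by rewrite fineK// fin_num_measure. Qed.

Let muSC : mu (~` S) = (1 - F)%:E.
Proof. by rewrite probability_setC// muS. Qed.

Let a_gt0 : (0 < a)%R.
Proof. by rewrite divr_gt0// (lt_trans F0). Qed.

Let b_gt0 : (0 < b)%R.
Proof. by rewrite divr_gt0// subr_gt0// (lt_trans Falpha). Qed.

Let b_lt_a : (b < a)%R.
Proof.
have F1 : (F < 1)%R by exact: lt_trans alpha1.
rewrite (@lt_trans _ _ 1%R)//.
  by rewrite ltr_pdivrMr ?subr_gt0// mul1r ltrD2l ltrN2.
by rewrite ltr_pdivlMr// mul1r.
Qed.

Lemma integral_tilt_density : \int[mu]_x (twoval S a b x)%:E = 1.
Proof.
rewrite integral_twoval//= !setTI muS muSC -!EFinM -EFinD /a /b.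
rewrite !divfK ?gt_eqF ?subr_gt0// ?(lt_trans Falpha)//.
by rewrite addrC subrK.
Qed.

Section lower_bound.
Variable mu' : probability (\bar R) R.
Hypothesis dom : mu' `<< mu.
(** This version of the density is finite and nonnegative at every point, so it can be handled
    pointwise; it is identified with [Radon_Nikodym] only almost everywhere. *)
Let phi := Radon_Nikodym_SigmaFinite.f mu' mu.
Let phr x := fine (phi x).
(* [expR (- ln y)] is [y^-1] for [0 < y] and is manifestly measurable. *)
Let h x := (twoval S a b x * expR (- ln (phr x)))%R.

Let phrE x : (phr x)%:E = phi x.
Proof. by rewrite /phr fineK// Radon_Nikodym_SigmaFinite.f_fin_num. Qed.

Let phr_ge0 x : (0 <= phr x)%R.
Proof. by rewrite -lee_fin phrE Radon_Nikodym_SigmaFinite.f_ge0. Qed.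

Let measurable_phi : measurable_fun setT phi.
Proof. exact: measurable_int (Radon_Nikodym_SigmaFinite.f_integrable dom). Qed.

Let measurable_phr : measurable_fun setT phr.
Proof. exact: measurableT_comp. Qed.

Let twoval_gt0 x : (0 < twoval S a b x)%R.
Proof. by rewrite /twoval; case: ifP. Qed.

Let h_ge0 x : (0 <= h x)%R.
Proof. by rewrite mulr_ge0 ?expR_ge0// ltW. Qed.

Let measurable_h : measurable_fun setT h.
Proof.
apply: measurable_funM; first exact: measurable_twoval.
apply: measurableT_comp => //; apply: measurableT_comp => //.
by apply: measurableT_comp => //; exact: measurable_ln.
Qed.

(** Moving to [mu] multiplies [h] by [phi]; the product is the tilted density where [phr] is
    positive and 0 elsewhere, so its integral is at most the total mass 1. *)
Let int_h_le1 : \int[mu']_x (h x)%:E <= 1.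
Proof.
rewrite -(@Radon_Nikodym_SigmaFinite.change_of_variables _ _ _ mu' mu dom
  (fun x => (h x)%:E) setT) //; last exact/measurable_EFinP.
rewrite -integral_tilt_density; apply: ge0_ae_le_integralT => [x|x|].
- by rewrite mule_ge0// ?lee_fin// Radon_Nikodym_SigmaFinite.f_ge0.
- by rewrite lee_fin ltW.
- apply: aeW => x; rewrite -/(phi x) -phrE -EFinM lee_fin /h -mulrA.
  rewrite ler_piMr ?(ltW (twoval_gt0 x))//.
  have [->|x0] := eqVneq (phr x) 0%R; first by rewrite mulr0.
  have {}x0 : (0 < phr x)%R by rewrite lt0r x0 phr_ge0.
  by rewrite expRN lnK ?posrE// mulVf// gt_eqF.
Qed.

(** The zero set of the density has [mu']-mass equal to the integral of the density over it, that is
    0. *)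
Let phr_gt0 : {ae mu', forall x, (0 < phr x)%R}.
Proof.
have mN : measurable (phr @^-1` [set 0%R]).
  by rewrite -[X in measurable X]setTI; exact: measurable_phr.
exists (phr @^-1` [set 0%R]); split => //.
  have -> : mu' (phr @^-1` [set 0%R]) = \int[mu]_(x in phr @^-1` [set 0%R]) phi x.
    exact: Radon_Nikodym_SigmaFinite.f_integral.
  by apply: integral0_eq => x /= x0; rewrite -phrE x0.
move=> x /= /negP; rewrite -leNgt => x0; apply/eqP.
by rewrite eq_le x0 phr_ge0.
Qed.

Lemma tilted_entropy_le_int_ln : alpha%:E <= mu' S ->
  (alpha * ln a + (1 - alpha) * ln b)%:E <=
  \int[mu']_x (ln (fine (Radon_Nikodym (charge_of_finite_measure mu') mu x)))%:E.
Proof.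
move=> alphaS; set p := fine (mu' S).
have pE : mu' S = p%:E by rewrite fineK// fin_num_measure.
have pCE : mu' (~` S) = (1 - p)%:E by rewrite probability_setC// pE.
rewrite (@ae_eq_integralT _ _ _ mu' _ (fun x => (ln (phr x))%:E)); last first.
  have := ae_eq_Radon_Nikodym_SigmaFinite dom measurableT.
  move=> /(null_dominates_ae_eq measurableT dom).
  by apply: filterS => x /(_ I) <-.
have hi : mu'.-integrable setT (EFin \o h).
  apply/integrableP; split; first exact/measurable_EFinP.
  under eq_integral do rewrite gee0_abs ?lee_fin//=.
  by rewrite (le_lt_trans int_h_le1)// ltry.
(* Gibbs: [ln phr >= ln g + 1 - g / phr] for the tilted density [g], and
   [g / phr] has [mu']-integral at most 1. *)
pose k x := (twoval S (ln a + 1) (ln b + 1) x)%:E - (h x)%:E.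
apply: (@le_trans _ _ (\int[mu']_x k x)); last first.
  apply: ae_le_integralT; apply: filterS phr_gt0 => x x0.
  rewrite /k -EFinB lee_fin /h expRN lnK ?posrE//.
  by rewrite /twoval; case: ifP => _; exact: ln_ge_1BV.
rewrite integralB//; last exact: integrable_twoval.
rewrite integral_twoval//= !setTI pE pCE -!EFinM -EFinD.
have [q hE] : exists q, \int[mu']_x (h x)%:E = q%:E.
  by exists (fine (\int[mu']_x (h x)%:E)); rewrite fineK// integrable_fin_num.
have : q%:E <= 1 by rewrite -hE.
rewrite hE -EFinB !lee_fin => q1.
have lnba : (ln b < ln a)%R by rewrite ltr_ln ?posrE.
move: alphaS; rewrite pE lee_fin => alphap.
(* The right side minus the left side is [(p - alpha) * (ln a - ln b) + (1 - q)], and both summands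
   are nonnegative. *)
nra.
Qed.

End lower_bound.

Lemma rel_entropy_ge (mu' : probability (\bar R) R) : alpha%:E <= mu' S ->
  (alpha * ln a + (1 - alpha) * ln b)%:E <= rel_entropy mu' mu.
Proof.
move=> alphaS; rewrite /rel_entropy; case: pselect => [dom|_]; last exact: leey.
exact: tilted_entropy_le_int_ln.
Qed.

(** The log-density takes the values [ln a] on [S] and [ln b] off [S], and [mu'] gives these sets
    the masses [alpha] and [1 - alpha]. Domination turns the [mu]-almost everywhere form of the
    density into a [mu']-almost everywhere one. *)
Lemma rel_entropy_tilt (mu' : probability (\bar R) R) :
  (forall A, measurable A ->
    mu' A = a%:E * mu (A `&` S) + b%:E * mu (A `&` ~` S)) ->
  rel_entropy mu' mu = (alpha * ln a + (1 - alpha) * ln b)%:E.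
Proof.
move=> mu'E; rewrite /rel_entropy; case: pselect => [dom|]; last first.
  by case; exact: (@twoval_dominates _ _ _ _ mS mu
    (charge_of_finite_measure mu') a b mu'E).
rewrite (@ae_eq_integralT _ _ _ mu' _ (fun x => (twoval S (ln a) (ln b) x)%:E)).
  have mSC := measurableC mS.
  rewrite integral_twoval//= !setTI !mu'E// setIid setICr setICl !setIid.
  rewrite measure0 !mule0 adde0 add0e muS muSC -!EFinM -EFinD /a /b.
  rewrite !divfK ?gt_eqF ?subr_gt0// ?(lt_trans Falpha)//.
  by rewrite mulrC [in X in (_ + X)%R]mulrC.
have : ae_eq mu setT (Radon_Nikodym (charge_of_finite_measure mu') mu)
    (EFin \o twoval S a b).
  have := @Radon_Nikodym_twoval _ _ _ _ mS mu (charge_of_finite_measure mu') a b mu'E.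
  by apply: filterS => x ->.
move=> /(null_dominates_ae_eq measurableT dom).
by apply: filterS => x /(_ I) -> /=; rewrite /twoval; case: ifP.
Qed.

End tilted_entropy.

(** * The tilted measure and the value of the entropy infimum *)

Section mu_tilde_theory.
Local Open Scope ereal_scope.
Context (R : realType) (mu : probability (\bar R) R) (T alpha : R).
Hypotheses (mu_I : mu setI_ = 1) (T_gt0 : (0 < T)%R).
Let F := FTm mu T.
Hypotheses (F0 : (0 < F)%R) (Falpha : (F < alpha)%R) (alpha1 : (alpha < 1)%R).
Let a : R := (alpha / F)%R.
Let b : R := ((1 - alpha) / (1 - F))%R.
Let S := set0T T.
Let mS : measurable S := measurable_set0T T.

(** In the extended line the complement of [[0, T)] also contains the negative points, which are
    [mu]-null because [mu] is carried by [[0, +oo]]. This reconciles [mu_tilde] with a density that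
    is two-valued on the whole line. *)
Lemma mu_setTinfE A : measurable A ->
  mu (A `&` setTinf T) = mu (A `&` ~` set0T T).
Proof.
move=> mA; have mI : measurable (setI_ : set (\bar R)) by exact: emeasurable_itv.
have mIC := measurableC mI.
have -> : A `&` ~` set0T T = (A `&` setTinf T) `|` (A `&` ~` setI_).
  apply/seteqP; split=> x; rewrite /set0T /setTinf /setI_ /= !in_itv/=.
    move=> [Ax /negP]; rewrite negb_and -!ltNge -!leNgt => /orP[x0|Tx].
      by right; split => //; apply/negP; rewrite negb_and -ltNge x0.
    by left; rewrite Tx leey.
  move=> [[Ax /andP[Tx _]]|[Ax /negP]].
    by split => //; apply/negP; rewrite negb_and -leNgt Tx orbT.
  rewrite leey andbT -ltNge => x0; split => //.
  by apply/negP; rewrite negb_and -ltNge x0.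
rewrite measureU0//.
- by apply: measurableI => //; exact: measurable_setTinf.
- exact: measurableI.
- apply/eqP; rewrite eq_le measure_ge0 andbT.
  rewrite (_ : 0 = mu (~` setI_)); last by rewrite probability_setC// mu_I subee.
  by rewrite le_measure// inE//; exact: measurableI.
Qed.

Lemma mu_tildeE A : measurable A ->
  mu_tilde mu T alpha A = a%:E * mu (A `&` S) + b%:E * mu (A `&` ~` S).
Proof.
move=> mA; rewrite /mu_tilde /= /cadd /= /cscale /= /crestr0 mem_set//.
by rewrite /crestr /charge_of_finite_measure mu_setTinfE.
Qed.

(** Turning a charge into a measure asks for nonnegativity on all sets; on non-measurable ones
    [crestr0] has the default value 0. *)
Lemma mu_tilde_ge0 A : 0 <= mu_tilde mu T alpha A.
Proof.
have F1 : (F < 1)%R by exact: lt_trans alpha1.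
rewrite /mu_tilde /= /cadd /= /cscale /= /crestr0.
case: ifPn => [/[!inE] mA|_]; last by rewrite !mule0 adde0.
rewrite /crestr adde_ge0// mule_ge0//; rewrite ?lee_fin.
- by rewrite divr_ge0 ?ltW// (lt_trans F0).
- by rewrite divr_ge0 ?subr_ge0 ?ltW.
Qed.

Lemma mu_tilde_setT : mu_tilde mu T alpha setT = 1.
Proof.
rewrite mu_tildeE// -(@integral_tilt_density R mu S mS alpha F0 Falpha alpha1).
by rewrite integral_twoval.
Qed.

Lemma mu_tilde_probability :
  exists p : probability (\bar R) R, forall A, p A = mu_tilde mu T alpha A.
Proof.
pose m := measure_of_charge (mu_tilde mu T alpha) mu_tilde_ge0.
pose p : probability (\bar R) R := HB.pack m
  (Measure_isProbability.Build _ _ _ m mu_tilde_setT).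
by exists p.
Qed.

Lemma frakI_tilt :
  frakI mu T alpha = (alpha * ln a + (1 - alpha) * ln b)%:E.
Proof.
apply/eqP; rewrite eq_le; apply/andP; split; last first.
  apply: le_ereal_inf_tmp => _ [mu' [_ alphaS] <-].
  exact: rel_entropy_ge.
(* The infimum is attained at the tilted law, which is admissible: it is carried by [[0, +oo]] and
   gives [[0, T)] mass exactly [alpha]. *)
have [p pE] := mu_tilde_probability.
apply: ereal_inf_lbound; exists p.
  have mI : measurable (setI_ : set (\bar R)) by exact: emeasurable_itv.
  have SI : setI_ `&` S = S.
    apply/setIidr => x; rewrite /S /set0T /setI_ /= !in_itv/= => /andP[-> _].
    by rewrite leey.
  split.
    rewrite pE -mu_tilde_setT !mu_tildeE// SI setTI; congr (_ + _ * _).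
    rewrite -!mu_setTinfE//; congr (mu _); rewrite setTI; apply/setIidr => x.
    rewrite /setTinf /setI_ /= !in_itv/= => /andP[Tx ->]; rewrite andbT.
    by rewrite (le_trans _ Tx)// lee_fin ltW.
  rewrite pE mu_tildeE// setIid setICr measure0 mule0 adde0.
  have -> : mu S = F%:E by rewrite fineK// fin_num_measure.
  by rewrite -EFinM divfK// gt_eqF.
apply: rel_entropy_tilt => // A mA.
by rewrite pE mu_tildeE.
Qed.

Lemma dens_twoval : {ae mu, forall x, dens mu T alpha x = (twoval S a b x)%:E}.
Proof. by apply: Radon_Nikodym_twoval => // A mA; exact: mu_tildeE. Qed.

End mu_tilde_theory.

(** * Expectations of products over independent times *)

Section independent_products.
Local Open Scope ereal_scope.
Context d (Omega : measurableType d) (R : realType) (P : probability Omega R).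
Variables (mu : probability (\bar R) R) (tau : nat -> Omega -> \bar R).
Hypothesis mtau : forall n, measurable_fun setT (tau n).
Hypothesis iid : iid_with_law P tau setT mu.

Lemma measurable_tau_preimage n B : measurable B -> measurable (tau n @^-1` B).
Proof. by move=> mB; rewrite -[X in measurable X]setTI; exact: mtau. Qed.

Lemma ae_law n (Q : \bar R -> Prop) :
  {ae mu, forall x, Q x} -> {ae P, forall w, Q (tau n w)}.
Proof.
move=> [N [mN N0 QN]]; exists (tau n @^-1` N); split.
- exact: measurable_tau_preimage.
- by rewrite (iid.1 n I).
- by move=> w /= /QN.
Qed.

Lemma prod_indic_bigcap N (C : nat -> set (\bar R)) w :
  (\prod_(n < N) \1_(C n) (tau n w) =
   \1_(\bigcap_(n in [set n | n \in iota 0 N]) (tau n @^-1` C n)) w :> R)%R.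
Proof.
have [Cw|Cw] := pselect ((\bigcap_(n in [set n | n \in iota 0 N])
    (tau n @^-1` C n)) w).
  rewrite [RHS]indicE mem_set// big1// => i _.
  by rewrite indicE mem_set//; apply: (Cw i); rewrite /= mem_iota add0n ltn_ord.
rewrite [RHS]indicE memNset//.
have /existsNP[n /not_implyP[nN Cn]] := Cw.
move: nN; rewrite /= mem_iota add0n => nN.
by rewrite (bigD1 (Ordinal nN))//= indicE memNset// mul0r.
Qed.

Lemma measurable_bigcap_tau (s : seq nat) (C : nat -> set (\bar R)) :
  (forall n, measurable (C n)) ->
  measurable (\bigcap_(n in [set n | n \in s]) (tau n @^-1` C n)).
Proof.
move=> mC; apply: bigcap_measurableType => n _.
exact: measurable_tau_preimage.
Qed.

Lemma integral_prod_indic N (C : nat -> set (\bar R)) :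
  (forall n, measurable (C n)) ->
  \int[P]_w (\prod_(n < N) \1_(C n) (tau n w))%:E = \prod_(n < N) mu (C n).
Proof.
move=> mC; under eq_integral do rewrite prod_indic_bigcap.
rewrite integral_indic//= ?setIT; last exact: measurable_bigcap_tau.
rewrite iid.2//; last exact: iota_uniq.
rewrite -[X in iota _ X]subn0 big_mkord; apply: eq_bigr => n _.
by rewrite (iid.1 n I).
Qed.

Variables (S : set (\bar R)) (mS : measurable S) (u v : R).

(* Expanding the product of two-term sums over all choice functions
   ['I_N -> bool] reduces the claim to products of indicators. *)
Lemma integral_prod_twoval N (B : nat -> set (\bar R)) :
  (forall n, measurable (B n)) ->
  \int[P]_w (\prod_(n < N) (\1_(B n) (tau n w) * twoval S u v (tau n w)))%:E =
  \prod_(n < N) (u%:E * mu (B n `&` S) + v%:E * mu (B n `&` ~` S)).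
Proof.
move=> mB.
pose c (j : bool) : R := if j then u else v.
pose D n (j : bool) := B n `&` (if j then S else ~` S).
have mD n j : measurable (D n j).
  by apply: measurableI => //; case: j => //; exact: measurableC.
(* The sets chosen by [f] are extended by [setT] to indices from [N] on, since families of events
   are indexed by [nat]. *)
pose C (f : {ffun 'I_N -> bool}) n :=
  oapp (fun i : 'I_N => D i (f i)) setT (insub n).
have CE f (i : 'I_N) : C f i = D i (f i) by rewrite /C valK.
have mC f n : measurable (C f n) by rewrite /C; case: insub => [i|] /=.
have pE w : (\prod_(n < N) (\1_(B n) (tau n w) * twoval S u v (tau n w)) =
    \sum_(f : {ffun 'I_N -> bool})
      (\prod_(i < N) c (f i)) * \prod_(i < N) \1_(C f i) (tau i w))%R.
  transitivity
    (\prod_(n < N) \sum_(j : bool) c j * \1_(D n j) (tau n w))%R.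
    apply: eq_bigr => n _; rewrite big_bool /= /D !indicE !in_setI in_setC.
    rewrite /twoval; case: (_ \in S); case: (_ \in B n);
      by rewrite /= ?mulr0 ?mulr1 ?mul0r ?mul1r ?addr0 ?add0r.
  rewrite bigA_distr_bigA; apply: eq_bigr => f _; rewrite -big_split/=.
  by apply: eq_bigr => i _; rewrite CE.
under eq_integral do rewrite pE -sumEFin.
have iprod f : P.-integrable setT
    (fun w => (\prod_(i < N) \1_(C f i) (tau i w))%:E).
  under eq_fun do rewrite prod_indic_bigcap.
  by apply: integrable_indic => //; exact: measurable_bigcap_tau.
rewrite integral_sum//=; last first.
  move=> f; under eq_fun do rewrite EFinM.
  exact: integrableZl.
have fmu A : measurable A -> mu A = (fine (mu A))%:E.
  by move=> mA; rewrite fineK// fin_num_measure.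
transitivity (\prod_(n < N) \sum_(j : bool) c j * fine (mu (D n j)))%R%:E.
  rewrite bigA_distr_bigA -sumEFin; apply: eq_bigr => f _.
  under eq_integral do rewrite EFinM.
  rewrite integralZl// integral_prod_indic// big_split EFinM; congr (_ * _).
  rewrite -prodEFin; apply: eq_bigr => i _.
  by rewrite CE fmu.
rewrite -prodEFin; apply: eq_bigr => n _.
by rewrite big_bool EFinD !EFinM -!fmu.
Qed.

End independent_products.

(** * Stieltjes integrals against integrators constant before the right endpoint *)

Section stieltjes_integral_lemmas.
Local Open Scope ereal_scope.
Import numFieldNormedType.Exports.
Context (R : realType).
Implicit Types (F g : R -> R) (D : set R).

Lemma stieltjes_integral_ge0 F D g :
  (forall x, 0 <= g x)%R -> 0 <= stieltjes_integral F D g.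
Proof.
move=> g0; rewrite /stieltjes_integral; case: pselect => //= H.
by apply: integral_ge0 => x _; rewrite lee_fin.
Qed.

Lemma lebesgue_stieltjes_measure_itv_oc (cF : cumulative R R) (x y : R) :
  lebesgue_stieltjes_measure cF `]x, y] = wlength cF `]x, y].
Proof.
by rewrite /lebesgue_stieltjes_measure/= /measure_extension measurable_mu_extE//=;
  exact: is_ocitv.
Qed.

(** The intervals []a - 1, b - 1/(n+1)]] cover [[a, b[]; the left end [a - 1] keeps [a] inside, and
    intervals of this shape have their Stieltjes measure given by an increment of the integrator. *)
Lemma measure_itv_co_eq0 (m : {measure set (measurableTypeR R) -> \bar R})
    (a b : R) :
  (forall c, (c < b)%R -> m `](a - 1)%R, c]%classic = 0) ->
  m `[a, b[%classic = 0.
Proof.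
move=> m0; pose B n : set (measurableTypeR R) :=
  `](a - 1)%R, (b - n.+1%:R^-1)%R]%classic.
have mB n : m (B n) = 0 by apply: m0; rewrite ltrBlDr ltrDl.
have nB : m.-negligible (\bigcup_n B n).
  by apply: negligible_bigcup => n; exists (B n); split; rewrite ?mB// /B.
apply/measure_negligible => //; move: nB; apply: negligibleS => x /=.
rewrite in_itv/= => /andP[ax xb].
have [n bxn] := ltr_add_invr xb.
exists n => //=; rewrite /B/= in_itv/= lerBrDr (ltW bxn) andbT.
by rewrite (lt_le_trans _ ax)// ltrBlDr ltrDl.
Qed.

(** Constancy extends to the left of [a], which excludes an atom at [a] itself. *)
Lemma lebesgue_stieltjes_measure_cst (cF : cumulative R R) (a b : R) :
  {in `]-oo, b[ &, forall x y, cF x = cF y} ->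
  lebesgue_stieltjes_measure cF `[a, b[%classic = 0.
Proof.
move=> F0; apply: measure_itv_co_eq0 => c cb.
rewrite /= lebesgue_stieltjes_measure_itv_oc.
have [ca|ac] := leP c (a - 1)%R.
  by rewrite set_itv_ge ?wlength0// bnd_simp -leNgt.
rewrite wlength_itv_bnd/=; last exact: ltW.
by rewrite (F0 _ (a - 1)%R) ?subrr// in_itv/= ?cb// (lt_trans ac).
Qed.

Lemma stieltjes_integral_cst F g (a b : R) : measurable_fun setT g ->
  {in `]-oo, b[ &, forall x y, F x = F y} ->
  stieltjes_integral F `[a, b[%classic g = 0.
Proof.
move=> mg F0; rewrite /stieltjes_integral; case: pselect => //= H.
apply: null_set_integral => //.
  by apply/measurable_EFinP; exact: measurable_funTS.
exact: lebesgue_stieltjes_measure_cst.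
Qed.

End stieltjes_integral_lemmas.

Lemma Pprot_eq0 {d} {Omega : measurableType d} {R : realType}
    (tau : nat -> Omega -> \bar R) (T r alpha beta : R) N w :
  (forall n, tau n w \in (setI_ : set (\bar R))) -> alpha < beta -> (0 < N)%N ->
  gammaN tau T alpha N w <= 0 -> Pprot tau T r alpha beta N w = 0%E.
Proof.
move=> tauI ab N0; rewrite /gammaN big_split/= sumr_const card_ord => gamma0.
have N0' : 0 < N%:R :> R by rewrite ltr0n.
suff Lbar0 t : t < T -> LbarN tau alpha beta N w t = 0.
  apply: stieltjes_integral_cst => [|x y].
    apply: (measurableT_comp (@measurable_expR R)).
    by apply: measurableT_comp => //; apply: measurable_funM.
  by rewrite !in_itv/= => xT yT; rewrite !Lbar0.
(* As the times are nonnegative, [tau n w <= t < T] puts [tau n w] into [[0, T)]; the count in [LN]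
   is thus at most the one in [gammaN]. *)
move=> tT; have LN_le : LN tau N w t <= alpha.
  rewrite /LN ler_pdivrMl// mulr_natl -subr_le0.
  apply: le_trans gamma0; rewrite mulNrn lerD2r; apply: ler_sum => n _.
  rewrite ler_nat; case: (boolP (tau n w <= t%:E)%E) => // taut.
  rewrite mem_set//; move: (tauI n); rewrite inE /setI_ /set0T /= !in_itv/=.
  by move=> /andP[-> _] /=; rewrite (le_lt_trans taut)// lte_fin.
rewrite /LbarN !(max_idPr _) ?subrr ?mul0r// subr_le0//.
exact: le_trans (ltW ab).
Qed.

(** * Change of measure for the first [N] times *)

Section tilted_law.
Local Open Scope ereal_scope.
Context d (Omega : measurableType d) (R : realType) (P : probability Omega R).
Variables (mu : probability (\bar R) R) (tau : nat -> Omega -> \bar R).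
Hypothesis tauI : forall n w, tau n w \in (setI_ : set (\bar R)).
Hypothesis mtau : forall n, measurable_fun setT (tau n).
Hypothesis iid : iid_with_law P tau setT mu.
Variables (T alpha : R).
Hypothesis T_gt0 : (0 < T)%R.
Let F := FTm mu T.
Hypotheses (F0 : (0 < F)%R) (Falpha : (F < alpha)%R) (alpha1 : (alpha < 1)%R).
Let a : R := (alpha / F)%R.
Let b : R := ((1 - alpha) / (1 - F))%R.
Let S := set0T T.
Let kappa := (ln a - ln b)%R.
Let H := (alpha * ln a + (1 - alpha) * ln b)%R.

Let a_gt0 : (0 < a)%R.
Proof. by rewrite divr_gt0// (lt_trans F0). Qed.

Let b_gt0 : (0 < b)%R.
Proof. by rewrite divr_gt0// subr_gt0// (lt_trans Falpha). Qed.

Lemma law_setI : mu setI_ = 1.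
Proof.
have mI : measurable (setI_ : set (\bar R)) by exact: emeasurable_itv.
rewrite -(iid.1 0%N I)// (_ : _ @^-1` _ = setT) ?probability_setT//.
by apply/seteqP; split => // w _ /=; apply: set_mem; exact: tauI.
Qed.

Lemma ae_prod_dens N : {ae P, forall w,
  \prod_(n < N) dens mu T alpha (tau n w) =
  (\prod_(n < N) twoval S a b (tau n w))%:E}.
Proof.
have : {ae P, forall w, forall n,
    dens mu T alpha (tau n w) = (twoval S a b (tau n w))%:E}.
  apply: ae_foralln => n; apply: (@ae_law _ _ _ P mu tau mtau iid n
    (fun x => dens mu T alpha x = (twoval S a b x)%:E)).
  by apply: dens_twoval; exact: law_setI.
apply: filterS => w densE; rewrite -prodEFin.
by apply: eq_bigr => n _; exact: densE.
Qed.

(** The constants satisfy [kappa * (1 - alpha) + H = ln a] and [- kappa * alpha + H = ln b]. *)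
Lemma twoval_expR x :
  twoval S a b x = expR (kappa * ((x \in S)%:R - alpha) + H).
Proof.
rewrite /twoval /kappa /H; case: ifP => _ /=.
  by rewrite -[LHS]lnK ?posrE//; congr expR; ring.
by rewrite -[LHS]lnK ?posrE//; congr expR; ring.
Qed.

Lemma prod_twoval_expR N w :
  (\prod_(n < N) twoval S a b (tau n w) =
   expR (kappa * gammaN tau T alpha N w + N%:R * H))%R.
Proof.
under eq_bigr do rewrite twoval_expR.
rewrite -expR_sum; congr expR; rewrite big_split/= -mulr_sumr; congr (_ + _)%R.
by rewrite sumr_const card_ord mulr_natl.
Qed.

(** Padding with [setT] outside [s] makes the event a condition on all [N] times; the padded factors
    are [mu_tilde setT = 1]. Empty [s] gives the total mass, singletons the marginals, and general
    [s] independence. *)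
Lemma PtildeN_bigcap N (s : seq nat) (B : nat -> set (\bar R)) :
  uniq s -> (forall n, n \in s -> (n < N)%N) -> (forall n, measurable (B n)) ->
  PtildeN P mu tau T alpha N (\bigcap_(n in [set n | n \in s]) (tau n @^-1` B n))
  = \prod_(n <- s) mu_tilde mu T alpha (B n).
Proof.
move=> us sN mB; pose C n := if n \in s then B n else setT.
have mC n : measurable (C n) by rewrite /C; case: ifP.
have -> : \bigcap_(n in [set n | n \in s]) (tau n @^-1` B n) =
    \bigcap_(n in [set n | n \in iota 0 N]) (tau n @^-1` C n).
  apply/seteqP; split => w Bw n /= ns.
    by rewrite /C; case: ifPn => // ns'; exact: Bw.
  have := Bw n; rewrite /= mem_iota sN// /C ns; exact.
rewrite /PtildeN.
rewrite (@ae_eq_integralT _ _ _ P _ (fun w =>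
    (\prod_(n < N) (\1_(C n) (tau n w) * twoval S a b (tau n w)))%:E)); last first.
  apply: filterS (ae_prod_dens N) => w ->.
  by rewrite -prod_indic_bigcap -EFinM big_split.
rewrite (integral_prod_twoval _ _ _ P mu tau mtau iid)//; last first.
  exact: measurable_set0T.
transitivity (\prod_(n < N) mu_tilde mu T alpha (C n)).
  by apply: eq_bigr => n _; rewrite mu_tildeE// law_setI.
transitivity (\prod_(n < N | (n : nat) \in s) mu_tilde mu T alpha (B n)).
  rewrite [RHS]big_mkcond/=; apply: eq_bigr => n _; rewrite /C; case: ifP => // _.
  by rewrite mu_tilde_setT// law_setI.
rewrite -(big_mkord (mem s) (fun n => mu_tilde mu T alpha (B n))) -big_filter.
apply: perm_big.
apply: uniq_perm => //; first by rewrite filter_uniq// iota_uniq.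
move=> n; rewrite mem_filter mem_index_iota /=.
by case: (boolP (n \in s)) => //= /sN.
Qed.

Lemma PtildeN_setT N : PtildeN P mu tau T alpha N setT = 1.
Proof.
have := @PtildeN_bigcap N [::] (fun=> setT); rewrite big_nil => <- //.
by congr PtildeN; apply/seteqP; split.
Qed.

Lemma iid_PtildeN N : iid_with_law (PtildeN P mu tau T alpha N) tau
  [set n | (n < N)%N] (mu_tilde mu T alpha).
Proof.
have marginal n B : (n < N)%N -> measurable B ->
    PtildeN P mu tau T alpha N (tau n @^-1` B) = mu_tilde mu T alpha B.
  move=> nN mB; have := @PtildeN_bigcap N [:: n] (fun=> B).
  rewrite big_seq1 => <- //; last by move=> k; rewrite inE => /eqP ->.
  congr PtildeN; apply/seteqP; split => [w Bw k /=|w Bw].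
    by rewrite inE => /eqP ->.
  by apply: (Bw n); rewrite /= inE.
split => [n nN B mB|s B us sN mB]; first exact: marginal.
rewrite PtildeN_bigcap// big_seq [RHS]big_seq; apply: eq_bigr => n ns.
by rewrite marginal//; exact: sN.
Qed.

Lemma EtildeN_Pprot (r beta : R) N : (alpha < beta)%R -> (0 < N)%N ->
  EtildeN P mu tau T alpha N (fun w => Pprot tau T r alpha beta N w *
    (expR (- (kappa * gammaN tau T alpha N w)) *
     (0 < gammaN tau T alpha N w)%R%:R)%:E) =
  (expR (N%:R * H))%:E * \int[P]_w Pprot tau T r alpha beta N w.
Proof.
move=> ab N0; rewrite -ge0_integralTZl ?expR_gt0//; last first.
  by move=> w; apply: stieltjes_integral_ge0 => s; exact: expR_ge0.
rewrite /EtildeN; apply: ae_eq_integralT.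
apply: filterS (ae_prod_dens N) => w ->; rewrite prod_twoval_expR.
(* For positive [gammaN] the two exponentials in [kappa] cancel and leave [expR (N * H)]; otherwise
   both sides are 0. *)
have [g0|g0] := ltP 0%R (gammaN tau T alpha N w).
  rewrite mulr1 -muleA -EFinM -expRD addrA addNr add0r.
  by rewrite muleC.
by rewrite Pprot_eq0// !mul0e mule0.
Qed.

End tilted_law.

Theorem theorem4p1 (R : realType) (d : measure_display)
  (Omega : measurableType d) (P : probability Omega R)
  (mu : probability (\bar R) R) (tau : nat -> Omega -> \bar R)
  (T r alpha beta : R) :
  (* tau_n takes values in I = [0, +oo], is measurable, and the tau_n are iid with law mu *)
  (forall n w, tau n w \in (setI_ : set (\bar R))) ->
  (forall n, measurable_fun setT (tau n)) ->
  iid_with_law P tau setT mu ->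
  0 < T -> 0 <= r -> 0 <= alpha -> alpha < beta -> beta <= 1 ->
  FTm mu T < alpha -> 0 < FTm mu T ->
  (forall T', 0 <= T' < T -> (mu (set0T T') < mu (set0Tc T))%E) ->
  forall N : nat, (0 < N)%N ->
    let kappa := ln (alpha / (1 - alpha) * ((1 - FTm mu T) / FTm mu T)) in
    let I_N := EtildeN P mu tau T alpha N
      (fun w => (Pprot tau T r alpha beta N w *
                 (expR (- (kappa * gammaN tau T alpha N w)) *
                  (0 < gammaN tau T alpha N w)%R%:R)%:E)%E) in
    (\int[P]_w Pprot tau T r alpha beta N w =
       I_N * expeR (- ((N%:R)%:E * frakI mu T alpha)))%E /\
    PtildeN P mu tau T alpha N setT = 1%E /\
    iid_with_law (PtildeN P mu tau T alpha N) tau [set n | (n < N)%N]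
      (mu_tilde mu T alpha).
Proof.
move=> tauI mtau iid T0 r0 alpha0 ab b1 Falpha F0 _ N N0 kappa I_N.
have alpha1 : alpha < 1 by exact: lt_le_trans b1.
have muI := law_setI _ _ _ _ _ _ tauI iid.
split; last first.
  by split; [exact: PtildeN_setT|exact: iid_PtildeN].
have F1 : FTm mu T < 1 by exact: lt_trans alpha1.
(* The argument of the logarithm in [kappa] is the ratio of the two values of the tilted density. *)
have kappaE : kappa = ln (alpha / FTm mu T) - ln ((1 - alpha) / (1 - FTm mu T)).
  have a0 : 0 < alpha / FTm mu T by rewrite divr_gt0// (lt_trans F0).
  have b0 : 0 < (1 - alpha) / (1 - FTm mu T) by rewrite divr_gt0// subr_gt0.
  rewrite /kappa -ln_div ?posrE//; congr (ln _).
  field.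
  by rewrite !subr_eq0 !gt_eqF.
(* Once [frakI] is replaced by its real value, the last factor is the inverse of the constant
   extracted from [I_N]. *)
rewrite /I_N kappaE EtildeN_Pprot// frakI_tilt//.
rewrite -EFinM -EFinN /= muleC muleA -EFinM -expRD addNr expR0.
by rewrite mul1e.
Qed.
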